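(* Let $m,n$ be positive integers and let $\chi=(P_1,\ldots,P_{n+1})$ be a polynomial vector field of degree $m$ in $\mathbb{R}^{n+1}$. Put $d(m)=\frac{m-1}{2}$ if $m$ is odd and $d(m)=\frac{m}{2}$ if $m$ is even. Then $\chi$ is a vector field on $\mathbb{S}^n$ if and only if, for every $i\in\{1,\ldots,n+1\}$, $$P_i=\sum_{j=1}^{d(m)}\Big(1-\Big(\sum_{k=1}^{n+1}x_k^2\Big)^j\Big)f_{ij}+\sum_{j=1}^{n+1}A_{ij}x_j,$$ where each $f_{ij}\in\mathbb{R}[x_1,\ldots,x_{n+1}]$ is a polynomial of degree less than or equal to $m-2j$ and each $A_{ij}\in\mathbb{R}[x_1,\ldots,x_{n+1}]$ is a polynomial of degree less than or equal to $m-1$ such that $A=(A_{ij})$ is a skew-symmetric $(n+1)\times(n+1)$ matrix.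
   Context: $\mathbb{S}^n=\{x\in\mathbb{R}^{n+1} : \sum_{i=1}^{n+1}x_i^2-1=0\}$. A polynomial vector field $\chi=(P_1,\ldots,P_{d})$ in $\mathbb{R}^{d}$, with $P_i\in\mathbb{R}[x_1,\ldots,x_{d}]$, is identified with the differential operator $\chi=\sum_i P_i\,\partial/\partial x_i$; its degree is $\max_i\deg P_i$. A polynomial vector field $\chi$ in $\mathbb{R}^{n+1}$ is called a (polynomial) vector field on $\mathbb{S}^n$ if there is $K\in\mathbb{R}[x_1,\ldots,x_{n+1}]$ with $\chi\big(\sum_i x_i^2-1\big)=K\big(\sum_i x_i^2-1\big)$. *)

(* Defs.v *)
From HB Require Import structures.
From mathcomp Require Import all_boot all_order all_algebra.
From mathcomp Require Import reals.
From mathcomp Require Import mpoly.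

Set Implicit Arguments.
Unset Strict Implicit.
Unset Printing Implicit Defensive.

Import GRing.Theory.
Local Open Scope ring_scope.

(* Total degree; [msize] is the degree plus one, and the zero polynomial gets
   degree 0, so that it satisfies every bound [mpdeg p <= k]. *)
Definition mpdeg (R : realType) (d : nat) (p : {mpoly R[d]}) : nat :=
  (msize p).-1.

Definition sqnorm (R : realType) (d : nat) : {mpoly R[d]} :=
  \sum_(i < d) 'X_i ^+ 2.

Definition polyvf (R : realType) (d : nat) : Type := 'I_d -> {mpoly R[d]}.

Definition vf_degree (R : realType) (d : nat) (chi : polyvf R d) : nat :=
  (\max_(i < d) mpdeg (chi i))%N.

Definition vf_apply (R : realType) (d : nat) (chi : polyvf R d)
    (g : {mpoly R[d]}) : {mpoly R[d]} :=
  \sum_(i < d) chi i * g^`M(i).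

Definition vf_on_sphere (R : realType) (n : nat) (chi : polyvf R n.+1) : Prop :=
  exists K : {mpoly R[n.+1]},
    vf_apply chi (sqnorm R n.+1 - 1) = K * (sqnorm R n.+1 - 1).

Definition half_deg (m : nat) : nat :=
  if odd m then ((m - 1) %/ 2)%N else (m %/ 2)%N.

Definition skew_symmetric (R : realType) (d : nat)
    (A : 'M[{mpoly R[d]}]_d) : Prop := A^T = - A.

(* Main.v *)
Require Import Defs.
From HB Require Import structures.
From mathcomp Require Import all_boot all_order all_algebra.
From mathcomp Require Import reals.
From mathcomp Require Import mpoly.

Set Implicit Arguments.
Unset Strict Implicit.
Unset Printing Implicit Defensive.

Import GRing.Theory.
Local Open Scope ring_scope.

(** Write [S] for the squared norm; tangency to the sphere says that [S - 1]
    divides [\sum_i P_i x_i].  This condition does not see summands of [P_i] of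
    the form [(1 - S^j) f], because [S - 1] divides [1 - S^j]
    ([vf_on_sphere_radial]), and it holds for [A x] with [A] skew, for which
    the sum is zero ([skew_radial_eq0]).  Hence the stated fields are tangent.

    Conversely, on the sphere [S = 1], so each homogeneous part of [P_i] may be
    multiplied by a power of [S] until its degree is [m] or [m - 1], according
    to parity; the price is exactly a sum of terms [(1 - S^j) f_ij], where
    [f_ij] gathers the parts of degree [m - 2j] and [m - 2j - 1]
    ([sphere_homog_decomp]).  The resulting field [G = G^0 + G^1], with [G^e]
    homogeneous of degree [m - e], is again tangent, so [S - 1] divides
    [\sum_i G_i x_i].  This sum lives in the degrees [m] and [m + 1] only,
    whereas the lowest and the highest degree of a nonzero multiple of [S - 1]
    differ by at least [2]; therefore it vanishes ([homog_sub1_dvd_eq0]), and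
    so do its two homogeneous parts.  Finally, a homogeneous field orthogonal
    to the radial field is [A x] for a skew matrix [A], with an explicit formula
    coming from Euler's identity ([koszul_dhomog]). *)

(** * Euler's identity and exactness of the Koszul complex *)

Lemma dhomog_mderiv (R : nzRingType) (d k : nat) (i : 'I_d) (p : {mpoly R[d]}) :
  p \is k.-homog -> p^`M(i) \is k.-1.-homog.
Proof.
move=> /dhomogP hp; apply/dhomogP => m; rewrite mcoeff_msupp mcoeff_deriv => hm.
have /hp <- : (m + U_(i))%MM \in msupp p.
  by rewrite mcoeff_msupp; apply: contraNneq hm => ->; rewrite mul0rn.
by rewrite /= mdegD mdeg1 addn1.
Qed.

Lemma mderivXU (R : nzRingType) (d : nat) (i j : 'I_d) :
  ('X_j : {mpoly R[d]})^`M(i) = (j == i)%:R.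
Proof.
rewrite mderivX mnm1E; case: eqP => [->|_]; last by rewrite scale0r.
have -> : (U_(i) - U_(i) = 0 :> 'X_{1..d})%MM.
  by apply/mnmP => l; rewrite mnmBE subnn mnm0E.
by rewrite mpolyX0 scale1r.
Qed.

(** The monomial of exponent [m] is an eigenvector of [x_j d/dx_j] for the
    eigenvalue [m_j], and these eigenvalues add up to the degree. *)
Lemma euler_mderiv (R : comNzRingType) (d k : nat) (p : {mpoly R[d]}) :
  p \is k.-homog -> \sum_(j < d) p^`M(j) * 'X_j = p *+ k.
Proof.
move=> /dhomogP hp; apply/mpolyP => m; rewrite mcoeffMn raddf_sum /=.
have coef_j (j : 'I_d) : (p^`M(j) * 'X_j)@_m = p@_m *+ m j.
  have [mj0|mj_gt0] := posnP (m j).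
    rewrite mj0 mulr0n; apply: memN_msupp_eq0; apply/negP => /msuppM_le.
    move=> /allpairsP[[u v] /= [_ /mem_msuppXP <-] def_m].
    by move: mj0; rewrite def_m mnmDE mnm1E eqxx addn1.
  have le_jm : (U_(j) <= m)%MM.
    by apply/mnm_lepP => l; rewrite mnm1E; case: eqP => // <-.
  rewrite -{1}(submK le_jm) addmC -['X_j]/('X_[U_(j)]) addmC.
  rewrite (addmC (m - _)%MM) mcoeffMX mcoeff_deriv submK //.
  by rewrite mnmBE mnm1E eqxx subn1 prednK.
rewrite (eq_bigr (fun j : 'I_d => p@_m *+ m j)) // sumrMnr -mdegE.
have [/hp ->//|/memN_msupp_eq0 ->] := boolP (m \in msupp p).
by rewrite !mul0rn.
Qed.

(** Take [A_ij = (d_j G_i - d_i G_j) / (k + 1)].  Euler's identity gives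
    [\sum_j x_j d_j G_i = k G_i], and differentiating the hypothesis along
    [x_i] gives [\sum_j x_j d_i G_j = - G_i]; the difference is
    [(k + 1) G_i]. *)
Lemma koszul_dhomog (R : numFieldType) (d k : nat) (G : 'I_d -> {mpoly R[d]}) :
  (forall i, G i \is k.-homog) -> \sum_(i < d) G i * 'X_i = 0 ->
  exists A : 'M[{mpoly R[d]}]_d,
    [/\ forall i j, A i j \is k.-1.-homog,
        A^T = - A
      & forall i, G i = \sum_(j < d) A i j * 'X_j].
Proof.
move=> homG G0.
exists (\matrix_(i, j) (k.+1%:R^-1 *: ((G i)^`M(j) - (G j)^`M(i)))).
split=> [i j||i].
- by rewrite mxE rpredZ ?rpredB ?dhomog_mderiv.
- by apply/matrixP => i j; rewrite !mxE -scalerN opprB.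
have swap_i : \sum_(j < d) (G j)^`M(i) * 'X_j = - G i.
  have := congr1 (mderiv i) G0; rewrite mderiv0 raddf_sum /=.
  under eq_bigr do rewrite mderivM.
  rewrite big_split /= [X in _ + X](bigD1 i) //= [X in _ + (_ + X)]big1.
    by rewrite mderivXU eqxx mulr1 addr0 => /eqP; rewrite addr_eq0 => /eqP.
  by move=> j ne_ji; rewrite mderivXU (negbTE ne_ji) mulr0.
under eq_bigr do rewrite mxE -scalerAl mulrBl.
rewrite -scaler_sumr sumrB (euler_mderiv (homG i)) swap_i opprK -mulrSr.
by rewrite -scaler_nat scalerA mulVf ?scale1r // Num.Theory.pnatr_eq0.
Qed.

(** * Multiples of a homogeneous polynomial minus one *)

Lemma low_coeffs_homogM (R : nzRingType) (d e N : nat) (q p : {mpoly R[d]}) :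
  q \is e.-homog -> (forall m, (mdeg m < N)%N -> p@_m = 0) ->
  forall m, (mdeg m < e + N)%N -> (q * p)@_m = 0.
Proof.
move=> homq lowp m lt_m; apply: memN_msupp_eq0; apply/negP => /msuppM_le.
move=> /allpairsP[[u v] /= [/(dhomog_mf homq) du v_supp def_m]].
move: lt_m; rewrite def_m mdegD du ltn_add2l => /lowp v0.
by move: v_supp; rewrite mcoeff_msupp v0 eqxx.
Qed.

(** If [K] were nonzero, the lowest part of [K * (q - 1)] would be that of [- K]
    and the highest one [q] times that of [K], so their degrees would differ by
    at least [e].  There is no room for this between [N] and [e + N - 1]. *)
Lemma homog_sub1_dvd_eq0 (R : idomainType) (d e N : nat)
    (q K p : {mpoly R[d]}) :
  (0 < e)%N -> q != 0 -> q \is e.-homog ->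
  (forall m, (mdeg m < N)%N -> p@_m = 0) -> (msize p <= e + N)%N ->
  p = K * (q - 1) -> p = 0.
Proof.
move=> e_gt0 q_neq0 homq lowp szp def_p.
(* As [K = q * K - p], vanishing of [K] below degree [t] propagates to [t + 1]
   as long as [p] has no part in degree [t]. *)
have lowK : forall t, (t <= N)%N -> forall m, (mdeg m < t)%N -> K@_m = 0.
  elim=> // t IHt lt_tN m le_m.
  have -> : K = q * K - p by rewrite def_p mulrBr mulr1 mulrC subKr.
  rewrite mcoeffB lowp ?subr0; last exact: leq_trans le_m lt_tN.
  apply: (low_coeffs_homogM homq (IHt (ltnW lt_tN))).
  by apply: leq_trans le_m _; rewrite -add1n leq_add2r.
have [K0|K_neq0] := eqVneq K 0; first by rewrite def_p K0 mul0r.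
have szK : (N < msize K)%N.
  rewrite -(mlead_deg K_neq0) ltnS leqNgt; apply/negP => /(lowK _ (leqnn N)).
  by apply/eqP; rewrite -mcoeff_msupp mlead_supp.
have szq : (e < msize (q - 1))%N.
  have dq := dhomog_mf homq (mlead_supp q_neq0).
  rewrite -dq; apply: msize_mdeg_lt.
  rewrite mcoeff_msupp mcoeffB mcoeff1.
  have -> : mlead q == 0%MM = false by rewrite -mdeg_eq0 dq eqn0Ngt e_gt0.
  by rewrite subr0 -mcoeff_msupp mlead_supp.
have q1_neq0 : q - 1 != 0.
  by rewrite -msize_poly_eq0 -lt0n (leq_ltn_trans _ szq).
move: szp; rewrite def_p msizeM // leqNgt => /negP[].
case: (msize _) (msize _) szK szq => // a [//|b] aN be.
by rewrite addnS /= addSn ltnS addnC leq_add.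
Qed.

(** * Tangency to the sphere *)

Lemma sqnorm_dhomog (R : realType) (d : nat) : sqnorm R d \is 2.-homog.
Proof.
apply: rpred_sum => i _; rewrite -[2%N]mul1n.
by apply: dhomogMn; rewrite dhomogX /= mdeg1.
Qed.

Lemma sqnorm_neq0 (R : realType) (n : nat) : sqnorm R n.+1 != 0.
Proof.
apply/negP => /eqP /(congr1 (mcoeff (U_(ord0) *+ 2)%MM)) /eqP.
rewrite mcoeff0 raddf_sum /= (bigD1 ord0) //= big1 => [|i ne_i0].
  by rewrite addr0 mpolyXn mcoeffX eqxx oner_eq0.
rewrite mpolyXn mcoeffX; case: eqP => // /mnmP/(_ i).
by rewrite !mulmnE !mnm1E eqxx eq_sym (negbTE ne_i0).
Qed.

Lemma vf_apply_sqnorm (R : realType) (d : nat) (chi : polyvf R d) :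
  vf_apply chi (sqnorm R d - 1) = (\sum_(i < d) chi i * 'X_i) *+ 2.
Proof.
rewrite /vf_apply -sumrMnl; apply: eq_bigr => i _; rewrite -mulrnAr.
congr (_ * _); rewrite mderivB -mpolyC1 mderivC subr0 raddf_sum /=.
rewrite (bigD1 i) //= big1 => [|j ne_ji].
  by rewrite addr0 expr2 mderivM mderivXU eqxx mul1r mulr1.
by rewrite expr2 mderivM mderivXU (negbTE ne_ji) mul0r mulr0 addr0.
Qed.

Lemma vf_on_sphereP (R : realType) (n : nat) (chi : polyvf R n.+1) :
  vf_on_sphere chi <->
  exists K, \sum_(i < n.+1) chi i * 'X_i = K * (sqnorm R n.+1 - 1).
Proof.
split=> [[K]|[K def_chi]]; last first.
  by exists (K *+ 2); rewrite vf_apply_sqnorm def_chi mulrnAl.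
rewrite vf_apply_sqnorm => def_chi; exists (2^-1 *: K).
rewrite -scalerAl -def_chi -scaler_nat scalerA mulVf ?scale1r //.
by rewrite Num.Theory.pnatr_eq0.
Qed.

(** Tangency depends only on the restriction of the field to the sphere, where
    the factors [1 - S ^+ j] vanish; algebraically, [S - 1] divides
    [1 - S ^+ j]. *)
Lemma vf_on_sphere_radial (R : realType) (n h : nat) (chi G : polyvf R n.+1)
    (f : 'I_n.+1 -> nat -> {mpoly R[n.+1]}) :
  (forall i, chi i =
     \sum_(1 <= j < h.+1) (1 - sqnorm R n.+1 ^+ j) * f i j + G i) ->
  vf_on_sphere chi <-> vf_on_sphere G.
Proof.
move=> def_chi; set S := sqnorm R n.+1.
have [L def_L] : exists L,
    \sum_(i < n.+1) chi i * 'X_i = L * (S - 1) + \sum_(i < n.+1) G i * 'X_i.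
  exists (\sum_(i < n.+1) (\sum_(1 <= j < h.+1)
            - (\sum_(l < j) S ^+ l) * f i j) * 'X_i).
  rewrite mulr_suml -big_split /=; apply: eq_bigr => i _.
  rewrite def_chi mulrDl; congr (_ + _).
  rewrite mulrAC; congr (_ * _); rewrite mulr_suml; apply: eq_bigr => j _.
  by rewrite -[1 - _]opprB subrX1 -mulrN -mulrA mulrC.
rewrite !vf_on_sphereP; split=> [[K def_K]|[K def_K]].
  by exists (K - L); rewrite mulrBl -def_K def_L addrC addKr.
by exists (L + K); rewrite mulrDl -def_K def_L.
Qed.

Lemma skew_radial_eq0 (R : numFieldType) (d : nat) (A : 'M[{mpoly R[d]}]_d) :
  A^T = - A -> \sum_(i < d) (\sum_(j < d) A i j * 'X_j) * 'X_i = 0.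
Proof.
move=> skewA; set s := LHS.
have def_s : s = - s.
  rewrite {1}/s; under eq_bigr do rewrite mulr_suml.
  rewrite exchange_big -sumrN; apply: eq_bigr => j _ /=.
  rewrite mulr_suml -sumrN; apply: eq_bigr => i _.
  have -> : A i j = - A j i.
    by have /matrixP/(_ j i) := skewA; rewrite !mxE.
  by rewrite !mulNr mulrAC.
have : 2%:R *: s = 0 by rewrite scaler_nat mulr2n {1}def_s addNr.
by move/(congr1 ( *:%R 2^-1)); rewrite scalerA mulVf ?Num.Theory.pnatr_eq0 //
  scale1r scaler0.
Qed.

(** * Raising all homogeneous parts to the two top degrees *)

Lemma big_ord_pairs (V : nmodType) (c : nat -> V) (k : nat) :
  \sum_(t < k.*2) c t = \sum_(j < k) (c j.*2 + c j.*2.+1).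
Proof.
elim: k => [|k IHk]; first by rewrite !big_ord0.
by rewrite doubleS !big_ord_recr /= IHk addrA.
Qed.

(** Homogeneous parts are indexed by codegree, so that the power of the squared
    norm which lifts the part of index [2j + e] to degree [m - e] is [j].  The
    value is [0] beyond [m], where truncated subtraction would otherwise repeat
    the constant part. *)
Definition codeg_part (R : nzRingType) (d m t : nat) (p : {mpoly R[d]}) :
    {mpoly R[d]} :=
  if (t <= m)%N then pihomog mdeg (m - t) p else 0.

Lemma codeg_part_dhomog (R : nzRingType) (d m t : nat) (p : {mpoly R[d]}) :
  codeg_part m t p \is (m - t).-homog.
Proof. by rewrite /codeg_part; case: ifP => _; rewrite ?pihomogP ?rpred0. Qed.

Lemma sum_codeg_part (R : nzRingType) (d m k : nat) (p : {mpoly R[d]}) :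
  (msize p <= m.+1)%N -> (m < k)%N -> p = \sum_(t < k) codeg_part m t p.
Proof.
move=> szp lt_mk; rewrite {1}(pihomog_partitionE szp).
rewrite (reindex_inj rev_ord_inj) /=.
rewrite (big_ord_widen k (fun t => pihomog mdeg (m - t) p)) // big_mkcond /=.
by apply: eq_bigr => t _; rewrite /codeg_part ltnS.
Qed.

(** For [p] of degree at most [m] and [e] equal to [0] or [1], this agrees on
    the sphere with the sum of the parts of [p] of degree congruent to [m - e]
    modulo [2]; it is their homogenization in degree [m - e], with the squared
    norm in place of the square of a new variable. *)
Definition sphere_homog (R : realType) (d m e : nat) (p : {mpoly R[d]}) :
    {mpoly R[d]} :=
  \sum_(j < (half_deg m).+1) sqnorm R d ^+ j * codeg_part m (j.*2 + e) p.

Lemma sphere_homog_dhomog (R : realType) (d m e : nat) (p : {mpoly R[d]}) :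
  sphere_homog m e p \is (m - e).-homog.
Proof.
apply: rpred_sum => j _; have [le_m|lt_m] := leqP (j.*2 + e) m; last first.
  by rewrite /codeg_part leqNgt lt_m mulr0 rpred0.
have -> : (m - e = 2 * j + (m - (j.*2 + e)))%N.
  by rewrite addnBA // mul2n subnDl.
exact: dhomogM (dhomogMn _ (sqnorm_dhomog _ _)) (codeg_part_dhomog _ _ _).
Qed.

Lemma half_degE m : half_deg m = m./2.
Proof.
rewrite /half_deg subn1 !divn2; case: ifP => //; case: m => //= m.
by rewrite uphalf_half => /negbTE ->.
Qed.

Lemma sphere_homog_decomp (R : realType) (d m : nat) (p : {mpoly R[d]}) :
  (msize p <= m.+1)%N ->
  p = \sum_(1 <= j < (half_deg m).+1) (1 - sqnorm R d ^+ j) *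
        (codeg_part m j.*2 p + codeg_part m j.*2.+1 p)
      + (sphere_homog m 0 p + sphere_homog m 1 p).
Proof.
move=> szp; have lt_m : (m < (half_deg m).+1.*2)%N.
  by rewrite half_degE -ltn_half_double.
set a := fun j => codeg_part m j.*2 p + codeg_part m j.*2.+1 p.
have {1}-> : p = \sum_(0 <= j < (half_deg m).+1) a j.
  rewrite {1}(sum_codeg_part szp lt_m) big_mkord.
  exact: (big_ord_pairs (fun t => codeg_part m t p)).
have -> : sphere_homog m 0 p + sphere_homog m 1 p =
          \sum_(0 <= j < (half_deg m).+1) sqnorm R d ^+ j * a j.
  rewrite big_mkord -big_split; apply: eq_bigr => j _ /=.
  by rewrite addn0 addn1 -mulrDr.
rewrite !(big_ltn (ltn0Sn _)) expr0 mul1r addrCA -big_split /=.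
by congr (_ + _); apply: eq_bigr => j _; rewrite mulrBl mul1r subrK.
Qed.

(** * The normal form *)

Lemma mpdeg_dhomog (R : realType) (d k : nat) (p : {mpoly R[d]}) :
  p \is k.-homog -> (mpdeg p <= k)%N.
Proof.
move=> homp; rewrite /mpdeg -subn1 leq_subLR add1n msizeE.
by apply/bigmax_leqP_seq => u /(dhomog_mf homp) /= -> _.
Qed.

Lemma mpdegD (R : realType) (d k : nat) (p q : {mpoly R[d]}) :
  (mpdeg p <= k)%N -> (mpdeg q <= k)%N -> (mpdeg (p + q) <= k)%N.
Proof.
rewrite /mpdeg -!subn1 !leq_subLR => szp szq.
by apply: leq_trans (msizeD_le _ _) _; rewrite geq_max szp.
Qed.

Theorem theorem1p1 (R : realType) (m n : nat) (hm : (0 < m)%N) (hn : (0 < n)%N)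
    (P : polyvf R n.+1) (hP : vf_degree P = m) :
  vf_on_sphere P <->
  exists (f : 'I_n.+1 -> nat -> {mpoly R[n.+1]}) (A : 'M[{mpoly R[n.+1]}]_n.+1),
    [/\ forall (i : 'I_n.+1) (j : nat), (1 <= j <= half_deg m)%N ->
          (mpdeg (f i j) <= m - 2 * j)%N,
        forall i j : 'I_n.+1, (mpdeg (A i j) <= m - 1)%N,
        skew_symmetric A
      & forall i : 'I_n.+1,
          P i = \sum_(1 <= j < (half_deg m).+1)
                  (1 - sqnorm R n.+1 ^+ j) * f i j
                + \sum_(j < n.+1) A i j * 'X_j].
Proof.
have szP i : (msize (P i) <= m.+1)%N.
  rewrite -[m.+1]add1n -leq_subLR subn1 -hP.
  exact: (leq_bigmax (F := fun i => mpdeg (P i))).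
set S := sqnorm R n.+1; split; last first.
  move=> [f [A [_ _ skewA def_P]]]; apply/(vf_on_sphere_radial def_P).
  apply/vf_on_sphereP; exists 0; rewrite mul0r; exact: skew_radial_eq0.
have def_P i := sphere_homog_decomp (szP i).
move/(vf_on_sphere_radial def_P)/vf_on_sphereP => [K].
under eq_bigr do rewrite mulrDl.
rewrite big_split /= => dvd_G.
have homX e i : sphere_homog m e (P i) * 'X_i \is (m - e + 1).-homog.
  by apply: dhomogM; rewrite ?sphere_homog_dhomog // dhomogX /= mdeg1.
set H0 := \sum_i _ in dvd_G; set H1 := \sum_i _ in dvd_G.
have homH0 : H0 \is m.+1.-homog.
  by apply: rpred_sum => i _; have := homX 0%N i; rewrite subn0 addn1.
have homH1 : H1 \is m.-homog.
  by apply: rpred_sum => i _; have := homX 1%N i; rewrite subnK.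
(* [H0 + H1] only has monomials of degree [m] and [m + 1]. *)
have H_eq0 : H0 + H1 = 0.
  apply: (@homog_sub1_dvd_eq0 _ _ 2 m S K) => //.
  - exact: sqnorm_neq0.
  - exact: sqnorm_dhomog.
  - move=> u lt_um; rewrite mcoeffD (dhomog_nemf_coeff homH0) ?add0r.
      by rewrite (dhomog_nemf_coeff homH1) // neq_ltn lt_um.
    by rewrite neq_ltn ltnS ltnW.
  - rewrite msizeE; apply/bigmax_leqP_seq => u.
    move=> /msuppD_le; rewrite mem_cat.
    by case/orP=> [/(dhomog_mf homH0)|/(dhomog_mf homH1)] /= -> _.
have H0_eq0 : H0 = 0.
  apply/eqP; apply: contraT => H0_neq0.
  have : H0 \is m.-homog.
    by have /eqP := H_eq0; rewrite addr_eq0 => /eqP ->; rewrite rpredN.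
  by move=> /(dhomog_uniq H0_neq0 homH0)/eqP; rewrite gtn_eqF.
have H1_eq0 : H1 = 0 by move: H_eq0; rewrite H0_eq0 add0r.
have [A0 [degA0 skewA0 def_A0]] :=
  koszul_dhomog (fun i => sphere_homog_dhomog m 0 (P i)) H0_eq0.
have [A1 [degA1 skewA1 def_A1]] :=
  koszul_dhomog (fun i => sphere_homog_dhomog m 1 (P i)) H1_eq0.
exists (fun i j => codeg_part m j.*2 (P i) + codeg_part m j.*2.+1 (P i)).
exists (A0 + A1); split=> [i j _|i j||i].
- rewrite mul2n; apply: mpdegD;
    apply: leq_trans (mpdeg_dhomog (codeg_part_dhomog _ _ _)) _ => //.
  by rewrite leq_sub2l.
- rewrite mxE subn1; apply: mpdegD.
    by have := mpdeg_dhomog (degA0 i j); rewrite subn0.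
  apply: leq_trans (mpdeg_dhomog (degA1 i j)) _.
  by rewrite subn1 leq_pred.
- by rewrite /skew_symmetric linearD /= skewA0 skewA1 opprD.
rewrite {1}def_P; congr (_ + _); rewrite def_A0 def_A1 -big_split /=.
by apply: eq_bigr => j _; rewrite mxE mulrDl.
Qed.
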